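(* Let $d\ge1$ and $0<\xi\le1$. Let $\mathcal J$ be a collection of non-empty subsets of $\{1,\dots,d\}$ and $\boldsymbol c=(c_J)_{J\in\mathcal J}$ non-negative constants such that: (1) $\{1\},\dots,\{d\}\in\mathcal J$ and $c_{\{j\}}=1$ for $j=1,\dots,d$; (2) $\sum_{j=1}^d u_j<\sum_{J\in\mathcal J}\max_{j\in J}u_j$ for all $\boldsymbol u\in\mathbb S_+$; (3) there exists at least one finite Borel measure $H$ on $\mathbb S_+$ with $\int_{\mathbb S_+}\max_{j\in J}u_j\,H(d\boldsymbol u)=c_J$ for all $J\in\mathcal J$. Let $\mathrm{val}(\mathcal L_\rho)$ be the infimum of $$\int_{\mathbb S_+}\big(u_1^\xi+\cdots+u_d^\xi\big)^{1/\xi}H(d\boldsymbol u)$$ over all finite Borel measures $H$ on $\mathbb S_+$ satisfying $\int_{\mathbb S_+}\max_{j\in J}u_j\,H(d\boldsymbol u)=c_J$ for all $J\in\mathcal J$. Then $\mathrm{val}(\mathcal L_\rho)$ equals the value of the linear program $$\inf_{\boldsymbol\beta\in\mathbb R_+^{2^d-1}}\ \sum_{\varnothing\ne J\subset\{1,\dots,d\}}|J|^{1/\xi}\beta_J$$ $$\text{subject to: }\ \sum_{\varnothing\ne K\subset\{1,\dots,d\}}\mathbb I\{K\cap J\ne\varnothing\}\,\beta_K=c_J\quad\text{for all }J\in\mathcal J,$$ where the coordinates of $\boldsymbol\beta=(\beta_K)$ are indexed by the non-empty subsets $K$ of $\{1,\dots,d\}$.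
   Context: $\mathbb S_+=\{\boldsymbol u\in[0,\infty)^d:\sum_{i=1}^du_i=1\}$ is the unit simplex; $\mathbb R_+=[0,\infty)$; $\mathbb I\{\cdot\}$ is the indicator; $\subset$ allows equality; all measures are non-negative. *)

(* Defs.v *)
From HB Require Import structures.
From mathcomp Require Import all_boot all_order all_algebra.
From mathcomp Require Import all_classical all_reals all_analysis.
Import Order.TTheory GRing.Theory Num.Theory numFieldNormedType.Exports.
Set Implicit Arguments.
Unset Strict Implicit.
Unset Printing Implicit Defensive.
Local Open Scope classical_set_scope.
Local Open Scope ring_scope.

(* The dimension is [n.+1], i.e. an arbitrary integer that is at least 1: the
   simplex is then inhabited, as a [measurableType] has to be. *)
Definition simplex_set (R : realType) (n : nat) : set 'rV[R]_n.+1 :=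
  [set u : 'rV[R]_n.+1 | (forall i, 0 <= u ord0 i) /\ \sum_i u ord0 i = 1].

Arguments simplex_set : clear implicits.

Definition simplex (R : realType) (n : nat) : Type := set_type (simplex_set R n).

HB.instance Definition _ (R : realType) (n : nat) :=
  Topological.copy (simplex R n) (set_type (simplex_set R n)).

Lemma vertex_simplex (R : realType) (n : nat) :
  delta_mx ord0 ord0 \in simplex_set R n.
Proof.
rewrite inE /=; split=> [i|]; first by rewrite mxE ler0n.
rewrite (bigD1 ord0) //= big1 ?mxE ?eqxx ?addr0 // => i /negPf i0.
by rewrite mxE eqxx i0.
Qed.

HB.instance Definition _ (R : realType) (n : nat) :=
  isPointed.Build (simplex R n) (SigSub (vertex_simplex R n)).

Definition coordinate (R : realType) (n : nat) (u : simplex R n) (j : 'I_n.+1) : R :=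
  (set_val u : 'rV[R]_n.+1) ord0 j.

Definition borel_simplex (R : realType) (n : nat) :=
  g_sigma_algebraType (@open (simplex R n)).

(* Coordinates are nonnegative, so starting the iterated maximum at 0 gives
   the true maximum over a nonempty [J]. *)
Definition max_coord (R : realType) (n : nat) (J : {set 'I_n.+1})
    (u : simplex R n) : R :=
  \big[Num.max/0]_(j in J) coordinate u j.

Definition moment_feasible (R : realType) (n : nat)
    (JJ : {set {set 'I_n.+1}}) (c : {set 'I_n.+1} -> R)
    (H : {finite_measure set (borel_simplex R n) -> \bar R}) : Prop :=
  forall J, J \in JJ -> (\int[H]_u (max_coord J u)%:E = (c J)%:E)%E.

Definition val_Lrho (R : realType) (n : nat) (xi : R)
    (JJ : {set {set 'I_n.+1}}) (c : {set 'I_n.+1} -> R) : \bar R :=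
  ereal_inf
    [set (\int[H]_u ((\sum_j coordinate u j `^ xi) `^ xi^-1)%:E)%E
    | H in [set H : {finite_measure set (borel_simplex R n) -> \bar R}
           | moment_feasible JJ c H]].

Definition nonempty_set (n : nat) := {K : {set 'I_n.+1} | K != finset.set0}.

Definition lp_feasible (R : realType) (n : nat)
    (JJ : {set {set 'I_n.+1}}) (c : {set 'I_n.+1} -> R)
    (beta : {ffun nonempty_set n -> R}) : Prop :=
  (forall K, 0 <= beta K) /\
  forall J, J \in JJ ->
    \sum_(K : nonempty_set n) (val K :&: J != finset.set0)%:R * beta K = c J.

Definition lp_value (R : realType) (n : nat) (xi : R)
    (JJ : {set {set 'I_n.+1}}) (c : {set 'I_n.+1} -> R) : \bar R :=
  ereal_inf
    [set (\sum_(J : nonempty_set n) #|val J|%:R `^ xi^-1 * beta J)%:E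
    | beta in [set beta : {ffun nonempty_set n -> R} | lp_feasible JJ c beta]].

(* Main.v *)
From HB Require Import structures.
Require Import Defs.
From mathcomp Require Import all_boot all_order all_algebra.
From mathcomp Require Import all_classical all_reals all_analysis.
From mathcomp Require Import measurable_realfun ring lra.
Import Order.TTheory GRing.Theory Num.Theory numFieldNormedType.Exports.
Local Open Scope ring_scope.

(* Every u in the simplex is a nonnegative combination of indicators of its
   superlevel sets, u = sum_K b_K(u) 1_K with
   b_K(u) = max(0, min_K u - max_{K^c} u). Along this decomposition every
   functional max_{j in J} u_j is additive, and the objective is superadditive
   by the reverse Minkowski inequality for exponents at most 1. Hence sending H
   to beta_K = int b_K dH preserves the constraints and does not increase the
   objective. Conversely, beta corresponds to the discrete measure with mass
   |K| beta_K at the centroid 1_K / |K| of each face, at the same cost. *)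

Set Implicit Arguments.
Unset Strict Implicit.

(** * Superadditivity of the objective for exponents at most 1 *)

(** Convexity of the power 1/p >= 1 is applied at s^p and t^p; raising the result to the power p,
    which is monotone, gives the claim. *)
Lemma powR_concave (R : realType) (p a s t : R) : 0 < p -> p <= 1 ->
  0 <= a <= 1 -> 0 <= s -> 0 <= t ->
  a * s `^ p + (1 - a) * t `^ p <= (a * s + (1 - a) * t) `^ p.
Proof.
move=> p0 p1 /andP[a0 a1] s0 t0.
have pV1 : 1 <= p^-1 by rewrite -[1]invr1 lef_pV2// posrE.
have pV : p * p^-1 = 1 by rewrite mulfV// gt_eqF.
have := @convex_powR R p^-1 pV1 (Itv01 a0 a1) (s `^ p) (t `^ p).
rewrite !inE /= !in_itv /= !andbT !powR_ge0 => /(_ isT isT).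
rewrite !convRE /= -!powRrM pV !powRr1// => h.
have b0 : 0 <= 1 - a by rewrite subr_ge0.
have w0 : 0 <= a * s `^ p + (1 - a) * t `^ p.
  by rewrite addr_ge0// mulr_ge0// powR_ge0.
have := @ge0_ler_powR _ p (ltW p0) _ _ _ _ h.
by rewrite -powRrM mulVf ?gt_eqF// powRr1//; apply; rewrite !nnegrE ?powR_ge0// addr_ge0// mulr_ge0.
Qed.

Section pnorm.
Variables (R : realType) (T : finType) (p : R).
Hypotheses (p0 : 0 < p) (p1 : p <= 1).
Implicit Types x y : T -> R.

(** With [p = xi] and [x = coordinate u] this is by conversion the integrand of [val_Lrho]. *)
Definition pnorm x : R := (\sum_i x i `^ p) `^ p^-1.

Let sum_ge0 x : 0 <= \sum_i x i `^ p.
Proof. by apply: sumr_ge0 => i _; exact: powR_ge0. Qed.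

Lemma pnorm_ge0 x : 0 <= pnorm x.
Proof. exact: powR_ge0. Qed.

Lemma pnormX x : pnorm x `^ p = \sum_i x i `^ p.
Proof. by rewrite -powRrM mulVf ?gt_eqF// powRr1. Qed.

Lemma le_pnorm x y : (forall i, 0 <= x i <= y i) -> pnorm x <= pnorm y.
Proof.
move=> xy; apply: ge0_ler_powR; rewrite ?nnegrE ?invr_ge0 ?(ltW p0)//.
apply: ler_sum => i _; have /andP[x0 xy_i] := xy i.
by apply: ge0_ler_powR; rewrite ?nnegrE ?(ltW p0)// (le_trans x0).
Qed.

Lemma pnormZ a x : 0 <= a -> (forall i, 0 <= x i) ->
  pnorm (fun i => a * x i) = a * pnorm x.
Proof.
move=> a0 x0; rewrite /pnorm.
under eq_bigr do rewrite powRM//.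
rewrite -mulr_sumr powRM ?powR_ge0//.
by rewrite -powRrM mulfV ?gt_eqF// powRr1.
Qed.

(** The origin of the costs |J|^(1/xi) in the linear program. *)
Lemma pnorm_indic (K : {set T}) :
  pnorm (fun i => (i \in K)%:R) = #|K|%:R `^ p^-1.
Proof.
rewrite /pnorm (eq_bigr (fun i => (i \in K)%:R)) => [|i _].
  by rewrite -natr_sum -big_mkcond /= sum1_card.
by case: (i \in K); rewrite ?powR1 ?powR0 ?gt_eqF.
Qed.

(* Reverse Minkowski: scaled to unit norm, [x] and [y] enter [x + y] through a
   convex combination, and [t `^ p] is concave. *)
Lemma pnormD x y : (forall i, 0 <= x i) -> (forall i, 0 <= y i) ->
  pnorm x + pnorm y <= pnorm (fun i => x i + y i).
Proof.
move=> x0 y0.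
(* Vanishing norms are settled by monotonicity, so that both norms can serve as divisors
   afterwards. *)
have [A0|A0] := leP (pnorm x) 0.
  have -> : pnorm x = 0 by apply/eqP; rewrite eq_le A0 pnorm_ge0.
  by rewrite add0r; apply: le_pnorm => i; rewrite y0 lerDr x0.
have [B0|B0] := leP (pnorm y) 0.
  have -> : pnorm y = 0 by apply/eqP; rewrite eq_le B0 pnorm_ge0.
  by rewrite addr0; apply: le_pnorm => i; rewrite x0 lerDl y0.
have unit z : 0 < pnorm z -> (forall i, 0 <= z i) ->
    \sum_i (z i / pnorm z) `^ p = 1.
  move=> C0 z0; rewrite -pnormX.
  rewrite (_ : (fun i => _) = (fun i => (pnorm z)^-1 * z i)); last first.
    by apply/funext => i; rewrite mulrC.
  rewrite pnormZ ?invr_ge0 ?ltW// mulVf ?gt_eqF//.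
  by rewrite powR1.
have := unit y B0 y0; have := unit x A0 x0; move: A0 B0 => {unit}.
move: (pnorm x) (pnorm y) => A B A0 B0 unitx unity.
have AB0 : 0 < A + B by rewrite addr_gt0.
(* With weights [a] and [1 - a], the convex combination of x/A and y/B is (x + y)/(A + B). *)
set a := A / (A + B).
have a01 : 0 <= a <= 1.
  by rewrite /a divr_ge0 ?(ltW A0) ?(ltW AB0)//= ler_pdivrMr// mul1r lerDl ltW.
have aE : 1 - a = B / (A + B).
  by rewrite /a -[1](@mulfV _ (A + B)) ?gt_eqF// -mulrBl addrAC subrr add0r.
have h i : (A + B) `^ p * (a * (x i / A) `^ p + (1 - a) * (y i / B) `^ p)
    <= (x i + y i) `^ p.
  have cv : a * (x i / A) `^ p + (1 - a) * (y i / B) `^ p <=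
      (a * (x i / A) + (1 - a) * (y i / B)) `^ p.
    by apply: powR_concave => //; rewrite divr_ge0 ?(ltW A0) ?(ltW B0).
  apply: le_trans (ler_wpM2l (powR_ge0 _ _) cv) _.
  have E : a * (x i / A) + (1 - a) * (y i / B) = (x i + y i) / (A + B).
    by rewrite aE /a; field; rewrite !gt_eqF.
  by rewrite E -powRM ?divr_ge0 ?addr_ge0 ?(ltW A0) ?(ltW AB0) ?(ltW B0)// mulrC divfK// gt_eqF.
(* Writing [A + B] as ((A + B)^p)^(1/p) reduces the claim to p-th powers, which [h] compares summand
   by summand. *)
rewrite -[leLHS]powRr1 ?(ltW AB0)// -[X in _ `^ X <= _](@mulfV _ p) ?gt_eqF//.
rewrite powRrM; apply: ge0_ler_powR;
  rewrite ?nnegrE ?invr_ge0 ?powR_ge0 ?(ltW p0)//.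
apply: le_trans (ler_sum _ (fun i _ => h i)).
rewrite -mulr_sumr big_split/= -!mulr_sumr.
by rewrite unitx unity !mulr1 addrC subrK mulr1.
Qed.

End pnorm.

(** * Layer decomposition of functions on a finite set *)

Section layers.
Variables (R : realType) (T : finType).
Implicit Types (u : T -> R) (J K L : {set T}).

(* The length of the interval of levels [t] with [{i | t < u i} = K], for [u]
   with values in [[0, 1]]. *)
Definition layer u K : R :=
  Num.max 0 (\big[Num.min/1]_(i in K) u i - \big[Num.max/0]_(i in ~: K) u i).

Lemma layer_ge0 u K : 0 <= layer u K.
Proof. by rewrite /layer le_max lexx. Qed.

Lemma layer_le1 u K : layer u K <= 1.
Proof.
rewrite /layer ge_max ler01 /= lerBlDr.
by rewrite (le_trans (bigmin_le_id _ _ _ _))// lerDl bigmax_ge_id.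
Qed.

(** The minimum over [K] is at most 0, while the maximum, started at 0, is nonnegative. *)
Lemma layer_eq0 u K i : i \in K -> u i = 0 -> layer u K = 0.
Proof.
move=> iK ui; apply/eqP; rewrite eq_le layer_ge0 andbT /layer ge_max lexx /=.
rewrite subr_le0 (@le_trans _ _ 0) ?bigmax_ge_id//.
by rewrite -ui; apply: bigmin_le_cond.
Qed.

Lemma bigmax_eq0 u J : (forall i, i \in J -> u i = 0) ->
  \big[Num.max/0]_(i in J) u i = 0.
Proof. by move=> u0; elim/big_rec: _ => // i x /u0-> ->; exact: maxxx. Qed.

(** * Removal of the lowest positive level *)

Section peel.
Variables (u : T -> R) (i0 : T).
Hypothesis (u01 : forall i, 0 <= u i <= 1).
Hypothesis (ui0 : 0 < u i0) (i0_min : forall i, 0 < u i -> u i0 <= u i).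

Definition supp : {set T} := [set i | 0 < u i]%SET.
Definition peel i : R := u i - u i0 * (i \in supp)%:R.

Lemma peel_supp i : i \in supp -> u i = peel i + u i0.
Proof. by rewrite /peel => ->; rewrite mulr1 subrK. Qed.

Lemma peelNsupp i : i \notin supp -> u i = 0 /\ peel i = 0.
Proof.
rewrite /peel => /[dup] iS /negPf ->; rewrite mulr0 subr0.
move: iS; rewrite inE -leNgt => ui.
by have -> : u i = 0 by apply/eqP; rewrite eq_le ui; case/andP: (u01 i).
Qed.

Lemma peel01 i : 0 <= peel i <= 1.
Proof.
have /andP[u0 u1] := u01 i.
have [iS|iS] := boolP (i \in supp); last by rewrite (peelNsupp iS).2 lexx ler01.
have uE := peel_supp iS; move: iS; rewrite inE => /i0_min iS.
by have := ui0 => ui0_gt0; apply/andP; split; lra.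
Qed.

Lemma peel_le i : u i <= peel i + u i0.
Proof.
have [/peel_supp -> //|/peelNsupp[-> ->]] := boolP (i \in supp).
by rewrite add0r ltW.
Qed.

Lemma card_supp_peel : (#|[set i | (0 < peel i)%R]%SET| < #|supp|)%N.
Proof.
apply: proper_card; apply/properP; split.
  apply/fintype.subsetP => i; rewrite inE; apply: contraLR => /peelNsupp[_ ->].
  by rewrite ltxx.
have i0S : i0 \in supp by rewrite inE.
by exists i0 => //; rewrite inE /peel i0S mulr1 subrr ltxx.
Qed.

(** If [J] meets the support, points outside it affect neither maximum, and on the support [u] and
    [peel] differ by the constant [u i0]. Otherwise both maxima vanish. *)
Lemma bigmax_peel J : \big[Num.max/0]_(i in J) u i =
  \big[Num.max/0]_(i in J) peel i + (supp :&: J != finset.set0)%:R * u i0.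
Proof.
have [SJ|/finset.set0Pn[j /finset.setIP[jS jJ]]] /= := eqVneq (supp :&: J) finset.set0.
  rewrite mul0r addr0; apply: eq_bigr => i iJ.
  suff /peelNsupp[-> -> //] : i \notin supp.
  apply/negP => iS; have : i \in supp :&: J by rewrite finset.in_setI iS.
  by rewrite SJ finset.in_set0.
rewrite mul1r; apply/eqP; rewrite eq_le; apply/andP; split.
  apply: bigmax_le => [|i iJ]; first by rewrite addr_ge0 ?bigmax_ge_id ?ltW.
  by rewrite (le_trans (peel_le i))// lerD2r; apply: le_bigmax_cond.
(* The default 0 and the points outside the support require [u i0] to be at most the maximum; [j]
   witnesses this. *)
rewrite -lerBrDr; apply: bigmax_le => [|i iJ]; rewrite lerBrDr.
  rewrite add0r (@le_trans _ _ (u j))//; last exact: le_bigmax_cond.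
  by apply: i0_min; move: jS; rewrite inE.
have [/peel_supp <-|/peelNsupp[_ ->]] := boolP (i \in supp).
  exact: le_bigmax_cond.
rewrite add0r (@le_trans _ _ (u j))//; last exact: le_bigmax_cond.
by apply: i0_min; move: jS; rewrite inE.
Qed.

(** Nonemptiness matters because of the default 1: for empty [L] the two sides would be 1 and
    [1 + u i0]. *)
Lemma bigmin_peel L : L != finset.set0 -> L \subset supp ->
  \big[Num.min/1]_(i in L) u i = \big[Num.min/1]_(i in L) peel i + u i0.
Proof.
move=> /finset.set0Pn[j jL] /fintype.subsetP LS; apply/eqP; rewrite eq_le; apply/andP; split.
  rewrite -lerBlDr; apply: le_bigmin => [|i iL]; rewrite lerBlDr.
    by rewrite (le_trans (bigmin_le_id _ _ _ _))// lerDl ltW.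
  by rewrite -peel_supp ?LS//; apply: bigmin_le_cond.
have h i : i \in L -> \big[Num.min/1]_(i in L) peel i + u i0 <= u i.
  by move=> iL; rewrite [leRHS]peel_supp ?LS// lerD2r; apply: bigmin_le_cond.
(* The default 1 is reached through [u j <= 1]. *)
apply: le_bigmin => // ; apply: le_trans (h j jL) _.
by case/andP: (u01 j).
Qed.

(** For [L = supp] the layer of [peel] vanishes at [i0] and that of [u] is [u i0]. If [L] leaves the
    support, both layers vanish. If [L] is strictly inside, its complement meets the support, so
    minimum and maximum both drop by [u i0]. *)
Lemma layer_peel L : L != finset.set0 ->
  layer u L = layer peel L + (L == supp)%:R * u i0.
Proof.
move=> L0; have i0S : i0 \in supp by rewrite inE.
have [->|LS] := eqVneq L supp.
  rewrite (@layer_eq0 peel _ i0)//; last by rewrite /peel i0S mulr1 subrr.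
  rewrite add0r mul1r /layer (_ : \big[Num.max/0]_(i in ~: supp) _ = 0); last first.
    by apply: bigmax_eq0 => i; rewrite inE => /peelNsupp[].
  rewrite subr0 (_ : \big[Num.min/1]_(i in supp) u i = u i0) ?max_r ?ltW//.
  apply/eqP; rewrite eq_le; apply/andP; split; first exact: bigmin_le_cond.
  apply: le_bigmin => [|i]; first by case/andP: (u01 i0).
  by rewrite inE => /i0_min.
rewrite mul0r addr0.
have [sLS|/subsetPn[i iL iS]] := boolP (L \subset supp); last first.
  by have [? ?] := peelNsupp iS; rewrite !(@layer_eq0 _ _ i).
rewrite /layer bigmin_peel// bigmax_peel.
have -> : supp :&: ~: L != finset.set0.
  rewrite -finset.setDE finset.setD_eq0; apply: contra LS => SL.
  by rewrite finset.eqEsubset sLS.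
by rewrite mul1r opprD addrACA subrr addr0.
Qed.

(** Only the layer of [supp] changes. [F] stays arbitrary so that one recursion serves both the
    constraint coefficients and the costs. *)
Lemma sum_layer_peel (F : {set T} -> R) :
  \sum_(K : {K : {set T} | K != finset.set0}) F (val K) * layer u (val K) =
  \sum_(K : {K : {set T} | K != finset.set0}) F (val K) * layer peel (val K)
  + F supp * u i0.
Proof.
have S0 : supp != finset.set0 by apply/finset.set0Pn; exists i0; rewrite inE.
under eq_bigr => K _ do rewrite layer_peel ?(valP K)// mulrDr.
rewrite big_split/=; congr (_ + _).
rewrite (bigD1 (Sub supp S0))//= eqxx mul1r big1 ?addr0// => K KS.
rewrite (_ : val K == supp = false) ?mul0r ?mulr0//.
by apply: contraNF KS => /eqP KS; apply/eqP/val_inj.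
Qed.

End peel.

Lemma sum_layer_const0 u (F : {set T} -> R) : (forall i, u i = 0) ->
  \sum_(K : {K : {set T} | K != finset.set0}) F (val K) * layer u (val K) = 0.
Proof.
move=> u0; apply: big1 => -[K /= /finset.set0Pn[i iK]] _.
by rewrite (@layer_eq0 _ _ i)// mulr0.
Qed.

(* Removing the minimum of [u] on its support strictly shrinks the support. *)
Lemma peel_ind (P : (T -> R) -> Prop) :
  (forall u, (forall i, u i = 0) -> P u) ->
  (forall u i0, (forall i, 0 <= u i <= 1) -> 0 < u i0 ->
    (forall i, 0 < u i -> u i0 <= u i) -> P (peel u i0) -> P u) ->
  forall u, (forall i, 0 <= u i <= 1) -> P u.
Proof.
move=> P0 PS u; have [k] := ubnP #|supp u|.
elim: k u => // k IH u uk u01.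
have [S0|/finset.set0Pn[j jS]] := eqVneq (supp u) finset.set0.
  apply: P0 => i; apply/eqP; rewrite eq_le; have /andP[-> _] := u01 i.
  by rewrite andbT leNgt; apply/negP => ui; move/setP: S0 => /(_ i); rewrite !inE ui.
rewrite inE in jS.
case: (@arg_minP _ _ _ j (fun i => 0 < u i) u jS) => i0 ui0 i0m.
apply: (PS u i0) => //; apply: IH; last exact: peel01.
by rewrite (leq_trans (card_supp_peel u01 ui0)).
Qed.

(** By peeling: each step lowers both sides by [u i0] if [J] meets the support, and by nothing
    otherwise. *)
Lemma sum_layer_max u J : (forall i, 0 <= u i <= 1) ->
  \sum_(K : {K : {set T} | K != finset.set0})
    (val K :&: J != finset.set0)%:R * layer u (val K) =
  \big[Num.max/0]_(i in J) u i.
Proof.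
move: u; apply: peel_ind => [u u0|u i0 u01 ui0 i0m IH].
  rewrite (@sum_layer_const0 u (fun K => (K :&: J != finset.set0)%:R))//.
  by rewrite bigmax_eq0.
rewrite (sum_layer_peel u01 ui0 i0m (fun K => (K :&: J != finset.set0)%:R)).
by rewrite IH (bigmax_peel u01 ui0 i0m).
Qed.

(** By peeling: the left side loses exactly the [pnorm] of the removed multiple of an indicator, and
    by [pnormD] the right side loses at least as much. *)
Lemma sum_layer_pnorm (p : R) u : 0 < p -> p <= 1 -> (forall i, 0 <= u i <= 1) ->
  \sum_(K : {K : {set T} | K != finset.set0})
    #|val K|%:R `^ p^-1 * layer u (val K) <= pnorm p u.
Proof.
move=> p0 p1; move: u; apply: peel_ind => [u u0|u i0 u01 ui0 i0m IH].
  rewrite (@sum_layer_const0 u (fun K => #|K|%:R `^ p^-1))//.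
  exact: pnorm_ge0.
rewrite (sum_layer_peel u01 ui0 i0m (fun K => #|K|%:R `^ p^-1)).
apply: (@le_trans _ _ (pnorm p (peel u i0) +
    pnorm p (fun i => u i0 * (i \in supp u)%:R))).
  by rewrite pnormZ ?(ltW ui0)// pnorm_indic// [u i0 * _]mulrC lerD2r.
apply: (le_trans (pnormD p0 p1 _ _)) => [i|i|].
- by case/andP: (peel01 u01 ui0 i0m i).
- by rewrite mulr_ge0 ?(ltW ui0).
- have E : (fun i => peel u i0 i + u i0 * (i \in supp u)%:R) = u.
    by apply/funext => i; rewrite subrK.
  by rewrite E lexx.
Qed.

End layers.

(** * Finite discrete measures *)

Lemma finite_atomic_measure d (T : measurableType d) (R : realType) (I : Type)
    (s : seq I) (w : I -> {nonneg R}) (p : I -> T) :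
  exists mu : {finite_measure set T -> \bar R},
    forall f : T -> \bar R, measurable_fun setT f -> (forall x, (0 <= f x)%E) ->
      (\int[mu]_x f x = \sum_(i <- s) (w i)%:num%:E * f (p i))%E.
Proof.
(* The induction builds a plain measure and carries finiteness as a property; the finite-measure
   structure is packed once, at the end. *)
suff [mu mufin muE] : exists2 mu : {measure set T -> \bar R}, fin_num_fun mu &
    forall f : T -> \bar R, measurable_fun setT f -> (forall x, (0 <= f x)%E) ->
      (\int[mu]_x f x = \sum_(i <- s) (w i)%:num%:E * f (p i))%E.
  have musig : sigma_finite setT mu.
    by apply: fin_num_fun_sigma_finite; first by rewrite measure0.
  pose fin := isFinite.Build _ _ _ _ mufin.
  pose sfin := isSFinite.Build _ _ _ _ (sfinite_measure_sigma_finite musig).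
  pose sigfin := isSigmaFinite.Build _ _ _ _ musig.
  pose nu : {finite_measure set T -> \bar R} :=
    HB.pack_for (FiniteMeasure.type T R) (Measure.sort mu) fin sfin sigfin.
  by exists nu => f mf f0; rewrite -muE//; exact: eq_measure_integral.
elim: s => [|i s [mu mufin muE]].
  exists mzero => [A mA//|f mf f0].
  by rewrite integral_measure_zero big_nil.
exists (measure_add (mscale (w i) (dirac (p i))) mu) => [A mA|f mf f0].
  rewrite -[X in X \is a _]/(measure_add (mscale (w i) (dirac (p i))) mu A).
  by rewrite measure_addE fin_numD mufin// andbT.
rewrite ge0_integral_measure_add// big_cons muE//; congr (_ + _)%E.
by rewrite ge0_integral_mscale// integral_dirac// diracT mul1e.
Qed.

(** * Measurability on the simplex *)

Section simplex.
Variables (R : realType) (n : nat).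
Implicit Types (u : simplex R n) (J : {set 'I_n.+1}).

Lemma coordinate_ge0 u j : 0 <= coordinate u j.
Proof. by have [+ _] : simplex_set R n (set_val u) := set_mem (valP u); apply. Qed.

Lemma coordinate01 u j : 0 <= coordinate u j <= 1.
Proof.
rewrite coordinate_ge0 /=; 
have [_ <-] : simplex_set R n (set_val u) := set_mem (valP u).
by rewrite (bigD1 j)//= lerDl sumr_ge0// => i _; exact: coordinate_ge0.
Qed.

(** Coordinates are continuous for the subspace topology, so preimages of open intervals, which
    generate the Borel sets of the line, are open. *)
Lemma measurable_coordinate j :
  measurable_fun setT (fun u : borel_simplex R n => coordinate u j).
Proof.
have cj : continuous (fun u : simplex R n => coordinate u j).
  move=> u; apply: (@continuous_comp _ _ _
    (set_val : simplex R n -> 'rV[R]_n.+1) (fun v : 'rV[R]_n.+1 => v ord0 j)).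
    exact: initial_continuous.
  exact: coord_continuous.
apply: (measurability _ (RGenOpens.measurableE R)).
move=> _ [_ [a [b ->] <-]]; rewrite setTI.
apply: sub_sigma_algebra.
by move/continuousP : cj; apply; exact: interval_open.
Qed.

Lemma measurable_bigmax d (X : measurableType d) (T : finType) (J : {set T})
    (f : T -> X -> R) a : (forall i, measurable_fun setT (f i)) ->
  measurable_fun setT (fun x => \big[Num.max/a]_(i in J) f i x).
Proof.
move=> mf; elim: (index_enum T) => [|i s IH].
  by under eq_fun do rewrite big_nil; exact: measurable_cst.
under eq_fun do rewrite big_cons.
by case: (i \in J) => //; exact: measurable_maxr.
Qed.

Lemma measurable_bigmin d (X : measurableType d) (T : finType) (J : {set T})
    (f : T -> X -> R) a : (forall i, measurable_fun setT (f i)) ->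
  measurable_fun setT (fun x => \big[Num.min/a]_(i in J) f i x).
Proof.
move=> mf; elim: (index_enum T) => [|i s IH].
  by under eq_fun do rewrite big_nil; exact: measurable_cst.
under eq_fun do rewrite big_cons.
by case: (i \in J) => //; exact: measurable_minr.
Qed.

Lemma measurable_layer K :
  measurable_fun setT (fun u : borel_simplex R n => layer (coordinate u) K).
Proof.
apply: measurable_maxr; first exact: measurable_cst.
apply: measurable_funB.
  by apply: measurable_bigmin => i; exact: measurable_coordinate.
by apply: measurable_bigmax => i; exact: measurable_coordinate.
Qed.

Lemma measurable_max_coord J :
  measurable_fun setT (fun u : borel_simplex R n => max_coord J u).
Proof. by apply: measurable_bigmax => i; exact: measurable_coordinate. Qed.

Lemma measurable_pnorm (xi : R) :
  measurable_fun setT (fun u : borel_simplex R n => pnorm xi (coordinate u)).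
Proof.
apply: (measurableT_comp (measurable_powR _)).
apply: measurable_sum => j; apply: (measurableT_comp (measurable_powR _)).
exact: measurable_coordinate.
Qed.

(** * Layer masses of a finite measure *)

Section layer_mass.
Variable H : {finite_measure set (borel_simplex R n) -> \bar R}.

(** The LP point attached to [H]. Nothing is lost by [fine]: layers are at most 1 and [H] has finite
    mass. *)
Definition layer_mass K : R := fine (\int[H]_u (layer (coordinate u) K)%:E)%E.

Lemma layer_massE K : (\int[H]_u (layer (coordinate u) K)%:E = (layer_mass K)%:E)%E.
Proof.
rewrite fineK// ge0_fin_numE; last first.
  by apply: integral_ge0 => u _; rewrite lee_fin layer_ge0.
apply: (@le_lt_trans _ _ (\int[H]_u (cst 1%:E u))%E).
  apply: ge0_le_integral => //.
  - by move=> u _; rewrite lee_fin layer_ge0.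
  - by apply/measurable_EFinP; exact: measurable_layer.
  - by move=> u _; rewrite lee_fin layer_le1.
by rewrite integral_cst// mul1e -ge0_fin_numE// fin_num_measure.
Qed.

Lemma layer_mass_ge0 K : 0 <= layer_mass K.
Proof.
by apply: fine_ge0; apply: integral_ge0 => u _; rewrite lee_fin layer_ge0.
Qed.

(** Used with [F] the constraint coefficients and with [F] the costs. *)
Lemma integral_sum_layer (F : {set 'I_n.+1} -> R) : (forall K, 0 <= F K) ->
  (\int[H]_u (\sum_(K : nonempty_set n) F (val K) * layer (coordinate u) (val K))%:E
   = (\sum_(K : nonempty_set n) F (val K) * layer_mass (val K))%:E)%E.
Proof.
move=> F0; under eq_integral do rewrite -sumEFin.
rewrite ge0_integral_sum//.
- rewrite -sumEFin; apply: eq_bigr => K _.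
  under eq_integral do rewrite EFinM.
  rewrite ge0_integralZl_EFin//; first by rewrite layer_massE -EFinM.
    by move=> u _; rewrite lee_fin layer_ge0.
  by apply/measurable_EFinP; exact: measurable_layer.
- move=> K; apply/measurable_EFinP; apply: measurable_funM => //.
  exact: measurable_layer.
- by move=> K u _; rewrite lee_fin mulr_ge0// layer_ge0.
Qed.

End layer_mass.

(** * Centroids of the faces *)

Lemma card_nonempty (K : nonempty_set n) : 0 < #|val K|%:R :> R.
Proof. by rewrite ltr0n card_gt0 (valP K). Qed.

Lemma centroid_simplex (K : nonempty_set n) :
  (\row_j (#|val K|%:R^-1 * (j \in val K)%:R)) \in simplex_set R n.
Proof.
rewrite inE; split=> [j|]; first by rewrite mxE mulr_ge0 ?invr_ge0 ?ler0n.
under eq_bigr do rewrite mxE.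
rewrite -mulr_sumr -natr_sum -big_mkcond /= sum1_card mulVf//.
by rewrite gt_eqF// card_nonempty.
Qed.

Definition centroid (K : nonempty_set n) : simplex R n := SigSub (centroid_simplex K).

Lemma coordinate_centroid (K : nonempty_set n) j :
  coordinate (centroid K) j = #|val K|%:R^-1 * (j \in val K)%:R.
Proof. by rewrite /coordinate /= mxE. Qed.

Lemma max_coord_centroid (K : nonempty_set n) J :
  max_coord J (centroid K) = #|val K|%:R^-1 * (val K :&: J != finset.set0)%:R.
Proof.
have V0 : 0 <= #|val K|%:R^-1 :> R by rewrite invr_ge0.
rewrite /max_coord; have [KJ|] /= := eqVneq (val K :&: J) finset.set0.
  rewrite mulr0; apply: bigmax_eq0 => j jJ; rewrite coordinate_centroid.
  have [jK|_] := boolP (j \in val K); last by rewrite mulr0.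
  have : j \in val K :&: J by rewrite finset.in_setI jK.
  by rewrite KJ finset.in_set0.
case/finset.set0Pn => j /finset.setIP[jK jJ]; rewrite mulr1.
apply/eqP; rewrite eq_le; apply/andP; split.
  apply: bigmax_le => // i _; rewrite coordinate_centroid.
  by rewrite ler_piMr// lern1 leq_b1.
by apply: (bigmax_sup j) => //; rewrite coordinate_centroid jK mulr1.
Qed.

Lemma pnorm_centroid (xi : R) (K : nonempty_set n) : 0 < xi ->
  pnorm xi (coordinate (centroid K)) = #|val K|%:R^-1 * #|val K|%:R `^ xi^-1.
Proof.
move=> xi0; rewrite (_ : coordinate _ = (fun j => #|val K|%:R^-1 * (j \in val K)%:R)).
  by rewrite pnormZ ?invr_ge0// pnorm_indic.
by apply/funext => j; exact: coordinate_centroid.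
Qed.

(** * Transfer of feasible points between the two programs *)

(** The pointwise identity [sum_layer_max], integrated against [H], becomes the linear
    constraint. *)
Lemma lp_feasible_layer_mass (JJ : {set {set 'I_n.+1}}) c
    (H : {finite_measure set (borel_simplex R n) -> \bar R}) :
  moment_feasible JJ c H -> lp_feasible JJ c [ffun K => layer_mass H (val K)].
Proof.
move=> Hc; split=> [K|J JJJ]; first by rewrite ffunE layer_mass_ge0.
under eq_bigr do rewrite ffunE.
apply: EFin_inj; rewrite -Hc//.
rewrite -(@integral_sum_layer H (fun K => (K :&: J != finset.set0)%:R))//.
apply: eq_integral => u _; congr (_%:E); apply: sum_layer_max => j.
exact: coordinate01.
Qed.

Lemma moment_feasible_centroids (JJ : {set {set 'I_n.+1}}) c
    (beta : {ffun nonempty_set n -> R}) (xi : R) : 0 < xi ->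
  lp_feasible JJ c beta ->
  exists2 H : {finite_measure set (borel_simplex R n) -> \bar R},
    moment_feasible JJ c H &
    (\int[H]_u (pnorm xi (coordinate u))%:E
     = (\sum_(K : nonempty_set n) #|val K|%:R `^ xi^-1 * beta K)%:E)%E.
Proof.
move=> xi0 [beta0 betac].
(* The factor |K| in the mass cancels the 1/|K| that the centroid brings into both the moments and
   the cost. *)
have w0 (K : nonempty_set n) : 0 <= #|val K|%:R * beta K by rewrite mulr_ge0.
have [H HE] := @finite_atomic_measure _ (borel_simplex R n) R _
  (index_enum (nonempty_set n)) (fun K => NngNum (w0 K)) centroid.
have K0 (K : nonempty_set n) : #|val K|%:R != 0 :> R.
  by rewrite gt_eqF// card_nonempty.
exists H => [J JJJ|]; rewrite HE.
- rewrite -betac// -sumEFin; apply: eq_bigr => K _ /=.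
  by rewrite -EFinM max_coord_centroid mulrACA (mulfV (K0 K)) mul1r mulrC.
- by apply/measurable_EFinP; exact: measurable_max_coord.
- by move=> u; rewrite lee_fin bigmax_ge_id.
- rewrite -sumEFin; apply: eq_bigr => K _ /=.
  by rewrite -EFinM pnorm_centroid// mulrACA (mulfV (K0 K)) mul1r mulrC.
- by apply/measurable_EFinP; exact: measurable_pnorm.
- by move=> u; rewrite lee_fin pnorm_ge0.
Qed.

End simplex.

Unset Implicit Arguments.
Set Strict Implicit.

(** * Equality of the two optimal values *)

Theorem theorem3p4 (R : realType) (n : nat) (xi : R)
    (JJ : {set {set 'I_n.+1}}) (c : {set 'I_n.+1} -> R)
    (xi_gt0 : 0 < xi) (xi_le1 : xi <= 1)
    (JJ_nonempty : forall J, J \in JJ -> J != finset.set0)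
    (c_ge0 : forall J, J \in JJ -> 0 <= c J)
    (singletons : forall j : 'I_n.+1, [set j]%SET \in JJ /\ c [set j]%SET = 1)
    (strict : forall u : simplex R n,
      \sum_j coordinate u j < \sum_(J in JJ) max_coord J u)
    (feasible : exists H : {finite_measure set (borel_simplex R n) -> \bar R},
      moment_feasible JJ c H) :
  val_Lrho xi JJ c = lp_value xi JJ c.
Proof.
apply/eqP; rewrite eq_le; apply/andP; split; apply/ereal_infP => v [].
(* Each LP point is matched by a measure of equal cost, so the moment value is at most the LP
   value. *)
- move=> beta /(moment_feasible_centroids xi_gt0)[H Hc HE] <- {v}.
  by apply: ereal_inf_lbound; exists H.
move=> H Hc <- {v}.
apply: (@le_trans _ _ (\sum_(K : nonempty_set n)
    #|val K|%:R `^ xi^-1 * layer_mass H (val K))%:E).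
  apply: ereal_inf_lbound; exists [ffun K => layer_mass H (val K)].
    exact: lp_feasible_layer_mass.
  by under eq_bigr do rewrite ffunE.
(* With the LP cost as an integral against [H], the comparison becomes the pointwise bound
   [sum_layer_pnorm]. *)
rewrite -(@integral_sum_layer _ _ H (fun K => #|K|%:R `^ xi^-1)); last first.
  by move=> K; exact: powR_ge0.
apply: ge0_le_integral => //.
- move=> u _; rewrite lee_fin sumr_ge0// => K _.
  by rewrite mulr_ge0 ?powR_ge0 ?layer_ge0.
- apply/measurable_EFinP; apply: measurable_sum => K.
  by apply: measurable_funM => //; exact: measurable_layer.
- by apply/measurable_EFinP; exact: measurable_pnorm.
- move=> u _; rewrite lee_fin; apply: sum_layer_pnorm => // j.
  exact: coordinate01.
Qed.
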